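(* Let $b\ge2$, $s\ge1$, $n\ge1$ be integers and let $P\subset\mathbb{Z}_b^{s\times n}$ be a subgroup. Then $$\mathcal{W}(P;\mu)=\sqrt{-1+\frac1{|P|}\sum_{B=(b_{i,j})\in P}\ \prod_{\substack{1\le i\le s\\1\le j\le n}}\bigl(1+\eta(b_{i,j})\,b^{-2j}\bigr)},$$ $$\mathcal{W}(P;\mu+h)=\sqrt{-1+\frac1{|P|}\sum_{B=(b_{i,j})\in P}\ \prod_{\substack{1\le i\le s\\1\le j\le n}}\bigl(1+\eta(b_{i,j})\,b^{-2(j+1)}\bigr)},$$ where $\eta(b_{i,j})=b-1$ if $b_{i,j}=0$ and $\eta(b_{i,j})=-1$ if $b_{i,j}\neq0$.
   Context: $\mathbb{Z}_b=\mathbb{Z}/b\mathbb{Z}$, and $\mathbb{Z}_b^{s\times n}$ is the additive group of $s\times n$ matrices over $\mathbb{Z}_b$. $\delta(a)=0$ if $a=0$ and $\delta(a)=1$ if $a\neq0$. The Dick weight is $\mu(A)=\sum_{i=1}^s\sum_{j=1}^n j\,\delta(a_{i,j})$ and the Hamming weight is $h(A)=\sum_{i=1}^s\sum_{j=1}^n\delta(a_{i,j})$ for $A=(a_{i,j})\in\mathbb{Z}_b^{s\times n}$. With $\omega_b=\exp(2\pi\sqrt{-1}/b)$ and $A\bullet B=\omega_b^{\sum_{i,j}a_{i,j}b_{i,j}}$, set $P^\perp=\{A\in\mathbb{Z}_b^{s\times n}\mid A\bullet B=1\text{ for all }B\in P\}$. Define $\mathcal{W}(P;\mu)=\sqrt{\sum_{A\in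 P^\perp\setminus\{0\}}b^{-2\mu(A)}}$ and $\mathcal{W}(P;\mu+h)=\sqrt{\sum_{A\in P^\perp\setminus\{0\}}b^{-2(\mu(A)+h(A))}}$. *)

(* Defs.v *)
From mathcomp Require Import all_boot all_order all_algebra all_fingroup.
From mathcomp Require Import all_classical all_reals all_analysis.
From mathcomp Require Import complex.

Set Implicit Arguments.
Unset Strict Implicit.
Unset Printing Implicit Defensive.

Import Order.TTheory GRing.Theory Num.Theory.
Local Open Scope ring_scope.

Definition cexp (R : realType) (z : R[i]) : R[i] :=
  let: (x +i* y)%C := z in
  ((expR x * cos y) +i* (expR x * sin y))%C.

Definition omega (R : realType) (b : nat) : R[i] :=
  cexp (2 * (pi : R)%:C%C * 'i%C / b%:R).

Definition delta (b : nat) (a : 'Z_b) : nat := if a == 0 then 0 else 1.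

(* Columns are indexed from 0 by ['I_n], so the column written j in
   1, ..., n is [j.+1] here. *)
Definition dick_weight (b s n : nat) (A : 'M['Z_b]_(s, n)) : nat :=
  \sum_(i < s) \sum_(j < n) j.+1 * delta (A i j).

Definition hamming_weight (b s n : nat) (A : 'M['Z_b]_(s, n)) : nat :=
  \sum_(i < s) \sum_(j < n) delta (A i j).

(* The exponent is computed in [nat], from the representatives in 0, ..., b - 1
   of the entries; the power of [omega R b] depends only on its class mod b. *)
Definition bullet (R : realType) (b s n : nat) (A B : 'M['Z_b]_(s, n)) : R[i] :=
  omega R b ^+ (\sum_(i < s) \sum_(j < n) A i j * B i j)%N.

Definition dual (R : realType) (b s n : nat) (P : {set 'M['Z_b]_(s, n)}) :
    {set 'M['Z_b]_(s, n)} :=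
  [set A | [forall B in P, bullet R A B == 1]].

Definition merit (R : realType) (b s n : nat)
    (P : {set 'M['Z_b]_(s, n)}) (w : 'M['Z_b]_(s, n) -> nat) : R :=
  Num.sqrt (\sum_(A in dual R P :\ 0) b%:R ^- (2 * w A)).

Definition eta (R : realType) (b : nat) (a : 'Z_b) : R :=
  if a == 0 then b%:R - 1 else -1.

(* Main.v *)
Require Import Defs.
From mathcomp Require Import all_boot all_order all_algebra all_fingroup.
From mathcomp Require Import all_classical all_reals all_analysis.
From mathcomp Require Import complex.
From mathcomp Require Import ring lra.

Import Order.TTheory GRing.Theory Num.Theory.
Local Open Scope ring_scope.

(** For each [A], the map [B |-> bullet A B] is a character of [P], trivial
    exactly when [A] lies in the dual; hence [\sum_(B in P) bullet A B] is
    [#|P|] or [0] accordingly.  Both [b ^- (2 * w A)] and [bullet A B] are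
    products over the entries of [A], so inserting this and exchanging sums
    turns the sum over the dual into the mean over [B] in [P] of a product of
    one-entry sums [\sum_a b ^- (2 * d * delta a) * omega ^+ (a * b_ij)], each of
    which is [1 + eta b_ij * b ^- (2 * d)].  The term [A = 0] contributes the
    [-1]. *)

(** Translation by [x0] permutes [G], so the sum equals [chi x0] times itself; since [chi x0] is not
    1 and [K] has no zero divisors, it vanishes. *)
Lemma sum_group_char (gT : finGroupType) (K : idomainType) (G : {group gT})
    (chi : gT -> K) (x0 : gT) :
  (forall x y, chi (x * y)%g = chi x * chi y) ->
  x0 \in G -> chi x0 != 1 -> \sum_(x in G) chi x = 0.
Proof.
move=> chiM Gx0 chi_x0.
have shift : \sum_(x in G) chi x = chi x0 * \sum_(x in G) chi x.
  rewrite big_distrr /= (reindex_inj (mulgI x0)) /=.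
  by apply: eq_big => [x|x _]; rewrite ?groupMl // chiM.
have /eqP : (1 - chi x0) * \sum_(x in G) chi x = 0.
  by rewrite mulrBl mul1r -shift subrr.
by rewrite mulf_eq0 subr_eq0 eq_sym (negbTE chi_x0) => /eqP.
Qed.

Lemma cis_exp (R : realType) (x : R) (k : nat) :
  (cos x +i* sin x)%C ^+ k = (cos (x *+ k) +i* sin (x *+ k))%C.
Proof.
elim: k => [|k IHk]; first by rewrite expr0 mulr0n cos0 sin0.
rewrite exprS IHk mulrS cosD sinD; congr (_ +i* _)%C.
by rewrite addrC [cos x * sin _]mulrC.
Qed.

Lemma omegaE (R : realType) (b : nat) :
  omega R b = (cos (2 * pi / b%:R) +i* sin (2 * pi / b%:R))%C.
Proof.
rewrite /omega.
have -> : 2 * (pi : R)%:C%C * 'i%C / b%:R = (0 +i* (2 * pi / b%:R))%C.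
  have -> : (b%:R : R[i]) = (b%:R)%:C%C by rewrite rmorph_nat.
  have -> : (2 : R[i]) = 2%:C%C by rewrite (rmorph_nat (real_complex R) 2).
  rewrite -fmorphV -rmorphM mulrAC -rmorphM /=.
  apply/eqP; rewrite eq_complex /=.
  by rewrite !(mulr0, mulr1, mul0r, subr0, addr0) !eqxx.
by rewrite /cexp expR0 !mul1r.
Qed.

Lemma omegaX1 (R : realType) (b : nat) : (0 < b)%N -> omega R b ^+ b = 1.
Proof.
move=> b_gt0; rewrite omegaE cis_exp -[_ / _ *+ b]mulr_natr.
rewrite divfK ?pnatr_eq0 -?lt0n //.
by rewrite mulr_natl cos2pi sin2pi.
Qed.

Lemma omegaX_neq1 (R : realType) (b k : nat) :
  (0 < k < b)%N -> omega R b ^+ k != 1.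
Proof.
move=> /andP[k_gt0 k_lt_b].
have b_gt0 : 0 < b%:R :> R by rewrite ltr0n (leq_trans _ k_lt_b).
rewrite omegaE cis_exp; apply/eqP => -[cos1 _].
(* Half the argument of [omega R b ^+ k]: it lies strictly between 0 and pi, where the sine is
   positive. *)
pose t : R := pi * k%:R / b%:R.
have tE : 2 * pi / b%:R *+ k = t *+ 2 :> R by rewrite /t; ring.
have t_gt0 : 0 < t by rewrite /t divr_gt0 // mulr_gt0 ?pi_gt0 ?ltr0n.
have t_ltpi : t < pi by rewrite /t ltr_pdivrMr // ltr_pM2l ?pi_gt0 // ltr_nat.
have : 0 < sin t by rewrite sin_gt0_pi ?t_gt0.
move: cos1; rewrite tE mulr2n cosD -!expr2 => cos1.
have := cos2Dsin2 t => cs sin_gt0.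
have : 0 < sin t ^+ 2 by rewrite exprn_gt0.
(* The double-angle formula gives [u - v = 1], which with [u + v = 1] forces [v = 0]. *)
by move: cos1 cs; set u := cos t ^+ 2; set v := sin t ^+ 2; lra.
Qed.

Lemma expr_mulZpD (K : pzSemiRingType) (z : K) (b : nat) (a x y : 'Z_b) :
  (1 < b)%N -> z ^+ b = 1 ->
  z ^+ (a * (x + y)%R)%N = z ^+ (a * x)%N * z ^+ (a * y)%N.
Proof.
(* Addition in ['Z_b] reduces modulo [(Zp_trunc b).+2], so the relation [z ^+ b = 1] is restated
   with that exponent; it then makes the reduction invisible to powers of [z]. *)
move=> b_gt1; rewrite -{1}(Zp_cast b_gt1) => zb.
by rewrite /= !exprM expr_mod ?exprD // exprAC zb expr1n.
Qed.

Lemma bulletE (R : realType) (b s n : nat) (A B : 'M['Z_b]_(s, n)) :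
  bullet R A B = \prod_(i < s) \prod_(j < n) omega R b ^+ (A i j * B i j)%N.
Proof.
by rewrite /bullet -prodrXr; apply: eq_bigr => i _; rewrite -prodrXr.
Qed.

Lemma bulletD (R : realType) (b s n : nat) (A B C : 'M['Z_b]_(s, n)) :
  (1 < b)%N -> bullet R A (B + C) = bullet R A B * bullet R A C.
Proof.
move=> b_gt1; rewrite !bulletE -big_split; apply: eq_bigr => i _ /=.
rewrite -big_split; apply: eq_bigr => j _ /=.
by rewrite mxE expr_mulZpD // omegaX1 // ltnW.
Qed.

Lemma sum_bullet (R : realType) (b s n : nat) (P : {group 'M['Z_b]_(s, n)})
    (A : 'M['Z_b]_(s, n)) :
  (1 < b)%N ->
  \sum_(B in P) bullet R A B = if A \in dual R P then #|P|%:R else 0.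
Proof.
move=> b_gt1; rewrite inE; case: ifPn => [/forall_inP trivA|].
  rewrite (eq_bigr (fun=> 1)) => [|B PB]; last exact/eqP/trivA.
  by rewrite sumr_const.
rewrite negb_forall_in => /exists_inP[B PB AB].
by apply: sum_group_char PB AB => x y; rewrite -bulletD.
Qed.

Lemma sum_dual (R : realType) (b s n : nat) (P : {group 'M['Z_b]_(s, n)})
    (f : 'M['Z_b]_(s, n) -> R[i]) :
  (1 < b)%N ->
  \sum_(A in dual R P) f A =
    #|P|%:R^-1 * \sum_(B in P) \sum_A f A * bullet R A B.
Proof.
move=> b_gt1; rewrite exchange_big big_distrr big_mkcond; apply: eq_bigr => A _.
rewrite -big_distrr sum_bullet //=; case: ifP => _; last by rewrite !mulr0.
by rewrite mulrC mulfK // pnatr_eq0 -lt0n cardG_gt0.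
Qed.

(** Generalized distributivity: expanding the product of sums picks one [a] for each position, and
    such a choice is exactly a matrix. *)
Lemma sum_matrix_prod (K : comNzRingType) (T : finType) (m n : nat)
    (F : 'I_m -> 'I_n -> T -> K) :
  \sum_(A : 'M[T]_(m, n)) \prod_(i < m) \prod_(j < n) F i j (A i j) =
  \prod_(i < m) \prod_(j < n) \sum_(a : T) F i j a.
Proof.
rewrite pair_big bigA_distr_bigA (reindex (@mx_val T m n)) /=; last first.
  by exists (@Matrix T m n) => [[f]|f].
by apply: eq_bigr => A _; rewrite pair_big; apply: eq_bigr => -[i j] _.
Qed.

Lemma sum_omegaX (R : realType) (b : nat) (y : 'Z_b) :
  (1 < b)%N ->
  \sum_(a : 'Z_b) omega R b ^+ (a * y)%N = if y == 0 then b%:R else 0.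
Proof.
move=> b_gt1; have [->|y_neq0] := eqVneq y 0.
  rewrite (eq_bigr (fun=> 1)) => [|a _]; last by rewrite muln0 expr0.
  by rewrite sumr_const card_ord Zp_cast.
have -> : \sum_(a : 'Z_b) omega R b ^+ (a * y)%N =
    \sum_(a in [set: 'Z_b]%G) omega R b ^+ (y * a)%N.
  by apply: eq_big => a; rewrite ?inE // mulnC.
pose chi (a : 'Z_b) := omega R b ^+ (y * a)%N.
(* The element 1 witnesses nontriviality: [chi 1] is [omega R b ^+ y] with [0 < y < b]. *)
apply: (@sum_group_char _ _ _ chi 1%R) => [x x'||]; rewrite ?inE /chi //.
  by rewrite expr_mulZpD // omegaX1 // ltnW.
rewrite muln1 omegaX_neq1 // lt0n y_neq0.
by have := ltn_ord y; rewrite [X in (_ < X)%N -> _]Zp_cast.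
Qed.

(** The weight is 1 at [a = 0] and constant at every other [a]. The powers of [omega R b] over
    nonzero [a] sum to the full character sum minus 1, that is [b - 1] or [-1], which is
    [eta R y]. *)
Lemma entry_sum (R : realType) (b d : nat) (y : 'Z_b) :
  (1 < b)%N ->
  \sum_(a : 'Z_b) b%:R ^- (2 * (d * delta a)) * omega R b ^+ (a * y)%N =
  (1 + eta R y * b%:R ^- (2 * d))%:C%C.
Proof.
move=> b_gt1; have := sum_omegaX R b y b_gt1.
rewrite (bigD1 0) //= mul0n expr0 addrC => /eqP.
rewrite eq_sym -subr_eq => /eqP sumE.
rewrite (bigD1 0) //= {1}/delta eqxx !muln0 mul0n !expr0 invr1 mulr1.
rewrite (eq_bigr (fun a : 'Z_b => b%:R ^- (2 * d) * omega R b ^+ (a * y)%N)).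
  rewrite -big_distrr -sumE /= rmorphD rmorphM fmorphV rmorphXn !rmorph_nat.
  rewrite mulrC rmorph1 /eta; case: ifP => _; congr (_ + _ * _).
    by rewrite rmorphB rmorph_nat rmorph1.
  by rewrite sub0r rmorphN rmorph1.
by move=> a a_neq0; rewrite /delta (negbTE a_neq0) muln1.
Qed.

(** Treats both weights at once: each charges a nonzero entry an amount [d j] depending only on its
    column. *)
Lemma merit_weightE (R : realType) (b s n : nat) (P : {group 'M['Z_b]_(s, n)})
    (d : 'I_n -> nat) (w : 'M['Z_b]_(s, n) -> nat) :
  (1 < b)%N ->
  (forall A, w A = \sum_(i < s) \sum_(j < n) d j * delta (A i j))%N ->
  merit R P w =
    Num.sqrt (-1 + #|P|%:R^-1 * \sum_(B in P) \prod_(i < s) \prod_(j < n)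
      (1 + eta R (B i j) * b%:R ^- (2 * d j))).
Proof.
move=> b_gt1 wE; congr Num.sqrt.
have w0 : w 0 = 0%N.
  rewrite wE big1 // => i _; rewrite big1 // => j _.
  by rewrite mxE /delta eqxx muln0.
have dual0 : 0 \in dual R P.
  rewrite inE; apply/forall_inP => B _; rewrite bulletE big1 // => i _.
  by rewrite big1 // => j _; rewrite mxE mul0n.
have -> : \sum_(A in dual R P :\ 0) b%:R ^- (2 * w A) =
    -1 + \sum_(A in dual R P) b%:R ^- (2 * w A) :> R.
  rewrite [in RHS](big_setD1 0) //= w0 muln0 expr0 invr1.
  by rewrite addrA addNr add0r.
(* The characters are complex-valued, so the real identity is proved after embedding into [R[i]]. *)
congr (-1 + _); apply: (fmorph_inj (real_complex R)).
rewrite rmorph_sum sum_dual // rmorphM fmorphV rmorph_nat; congr (_ * _).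
rewrite rmorph_sum; apply: eq_bigr => B _.
transitivity (\prod_(i < s) \prod_(j < n) \sum_(a : 'Z_b)
    b%:R ^- (2 * (d j * delta a)) * omega R b ^+ (a * B i j)%N); last first.
  rewrite rmorph_prod; apply: eq_bigr => i _; rewrite rmorph_prod.
  by apply: eq_bigr => j _; apply: entry_sum.
rewrite -(@sum_matrix_prod _ _ _ _ (fun i j a =>
  b%:R ^- (2 * (d j * delta a)) * omega R b ^+ (a * B i j)%N)).
apply: eq_bigr => A _.
rewrite bulletE fmorphV rmorphXn rmorph_nat wE big_distrr -prodrXr -prodfV.
rewrite -big_split; apply: eq_bigr => i _ /=.
rewrite big_distrr -prodrXr -prodfV -big_split.
by apply: eq_bigr => j _.
Qed.

Theorem corollary2 (R : realType) (b s n : nat)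
    (hb : (2 <= b)%N) (hs : (1 <= s)%N) (hn : (1 <= n)%N)
    (P : {group 'M['Z_b]_(s, n)}) :
  merit R P (@dick_weight b s n) =
    Num.sqrt (-1 + #|P|%:R^-1 * \sum_(B in P) \prod_(i < s) \prod_(j < n)
      (1 + eta R (B i j) * b%:R ^- (2 * j.+1)))
  /\
  merit R P (fun A => dick_weight A + hamming_weight A)%N =
    Num.sqrt (-1 + #|P|%:R^-1 * \sum_(B in P) \prod_(i < s) \prod_(j < n)
      (1 + eta R (B i j) * b%:R ^- (2 * (j.+1 + 1)))).
Proof.
split; first exact: merit_weightE.
(* A nonzero entry in column [j], counted from 0, contributes [j.+1] to the Dick weight and 1 to the
   Hamming weight. *)
apply: (@merit_weightE _ _ _ _ _ (fun j => j.+1 + 1)%N) => // A.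
rewrite -big_split; apply: eq_bigr => i _ /=.
by rewrite -big_split; apply: eq_bigr => j _ /=; rewrite mulnDl mul1n.
Qed.
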